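(* Every normed vector space admits a Lipschitz co-mixer, and every absolute Lipschitz retract admits a Lipschitz co-mixer.
   Context: A co-mixer on a metric space $X$ is a continuous map $\tau\colon X^3\to X$ such that $\tau(a,a,b)=\tau(a,b,a)=\tau(b,a,a)=b$ for all $a,b\in X$. It is called Lipschitz if it is Lipschitz as a map from $X^3$ (with, e.g., the maximum or sum product metric) to $X$; equivalently, there is a constant $L$ such that $\tau$ is $L$-Lipschitz in each of its three variables separately (for all fixed values of the other two). Normed spaces carry the metric $d(x,y)=\|x-y\|$. An absolute Lipschitz retract is a (nonempty) metric space $X$ such that for every metric space $Y$ containing $X$ isometrically as a subspace there is a Lipschitz map $r\colon Y\to X$ with $r(x)=x$ for all $x\in X$. *)

(* Defs.v *)
From HB Require Import structures.
From mathcomp Require Import all_boot all_order all_algebra.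
From mathcomp Require Import all_classical all_reals all_analysis.

Set Implicit Arguments.
Unset Strict Implicit.
Unset Printing Implicit Defensive.

Import Order.TTheory GRing.Theory Num.Theory.
Import numFieldNormedType.Exports.

Local Open Scope classical_set_scope.
Local Open Scope ring_scope.

(* The maximum metric, on top of the library's pseudometric (hence topology)
   on the product. *)
Section prod_metric.
Context {R : realType} {X Y : metricType R}.
Implicit Types p q : X * Y.

Let dist p q : R := Num.max (mdist p.1 q.1) (mdist p.2 q.2).

Let dist_ge0 p q : 0 <= dist p q.
Proof. by rewrite /dist le_max mdist_ge0. Qed.

Let dist_positivity p q : dist p q = 0 -> p = q.
Proof.
move=> pq0.
have /andP[p1 p2] : (mdist p.1 q.1 <= 0) && (mdist p.2 q.2 <= 0).
  by rewrite -ge_max -/(dist p q) pq0.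
case: p q p1 p2 {pq0} => [x y] [x' y'] /= p1 p2.
by congr pair; apply: mdist_positivity; apply/eqP; rewrite eq_le mdist_ge0 andbT.
Qed.

Let ballEdist p d : ball p d = [set q | dist p q < d].
Proof.
apply/seteqP; split=> q /=; rewrite /dist gt_max.
  by case; rewrite !ballEmdist /= => -> ->.
by case/andP => p1 p2; split; rewrite ballEmdist.
Qed.

HB.instance Definition _ := PseudoMetric_isMetric.Build R (X * Y)%type
  dist_ge0 dist_positivity ballEdist.

End prod_metric.

(* A normed space seen as a metric space; its pseudometric structure is the
   one it already has in the library. *)
Definition normed_metric (V : Type) : Type := V.

Section normed_metric.
Context {R : realType} {V : normedModType R}.
Implicit Types x y : normed_metric V.

HB.instance Definition _ := PseudoMetric.copy (normed_metric V) V.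

Let dist x y : R := `|(x : V) - (y : V)|.

Let dist_ge0 x y : 0 <= dist x y.
Proof. exact: normr_ge0. Qed.

Let dist_positivity x y : dist x y = 0 -> x = y.
Proof. by move/normr0_eq0/subr0_eq. Qed.

Let ballEdist x d : ball x d = [set y | dist x y < d].
Proof. by rewrite -[LHS]/(@ball R V x d) -ball_normE. Qed.

HB.instance Definition _ := PseudoMetric_isMetric.Build R (normed_metric V)
  dist_ge0 dist_positivity ballEdist.

End normed_metric.

Lemma mdist_prodE (R : realType) (X Y : metricType R) (p q : X * Y) :
  mdist p q = Num.max (mdist p.1 q.1) (mdist p.2 q.2).
Proof. by []. Qed.

Lemma mdist_normedE (R : realType) (V : normedModType R)
    (x y : normed_metric V) :
  mdist x y = `|(x : V) - (y : V)|.
Proof. by []. Qed.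

Section co_mixers.
Context {R : realType}.

(* The library's [lipschitz] is restricted to normed modules. *)
Definition metric_lipschitz (X Y : metricType R) (f : X -> Y) : Prop :=
  exists2 L : R, 0 <= L & forall x y, mdist (f x) (f y) <= L * mdist x y.

Definition isometric (X Y : metricType R) (f : X -> Y) : Prop :=
  forall x y, mdist (f x) (f y) = mdist x y.

Definition co_mixer (X : metricType R) (tau : X * X * X -> X) : Prop :=
  continuous tau /\
  forall a b, [/\ tau (a, a, b) = b, tau (a, b, a) = b & tau (b, a, a) = b].

Definition has_lipschitz_co_mixer (X : metricType R) : Prop :=
  exists tau : X * X * X -> X, co_mixer tau /\ metric_lipschitz tau.

(* A metric space containing X isometrically is given by an isometric
   embedding of X, along which the retraction is the identity. *)
Definition absolute_lipschitz_retract (X : metricType R) : Prop :=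
  [set: X] !=set0 /\
  forall (Y : metricType R) (i : X -> Y), isometric i ->
    exists r : Y -> X, metric_lipschitz r /\ forall x, r (i x) = x.

End co_mixers.

(* Main.v *)
Require Import Defs.
From HB Require Import structures.
From mathcomp Require Import all_boot all_order all_algebra.
From mathcomp Require Import all_classical all_reals all_analysis.
From mathcomp Require Import lra.

(** Let [S_t v] shorten the vector [v] by the length [t] without changing its
    direction, stopping at [0] (the soft thresholding of [v]).  In a normed
    space put [u := x - z], [v := y - z] and
    [tau (x, y, z) := z + S_|v| u + S_|u| v].
    If [x = y] then both vectors are shortened to [0], which leaves [z]; if
    [x = z] then [u = 0] and [v] is kept whole, which leaves [z + v = y]; the
    case [y = z] is symmetric.  So [tau] is a co-mixer, and it is Lipschitz
    because [(t, v) |-> S_t v] is ([dist_shrink]).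

    A Lipschitz retraction [r : Y -> X] turns a Lipschitz co-mixer [tau] of [Y]
    into the Lipschitz co-mixer [r \o tau] of [X], as the co-mixer identities
    only involve points of [X] ([lipschitz_retract_co_mixer]).  Finally, every
    nonempty metric space embeds isometrically into the normed space of bounded
    real functions on it ([dist_kuratowski]), of which an absolute Lipschitz
    retract is therefore a Lipschitz retract. *)

Set Implicit Arguments.
Unset Strict Implicit.
Unset Printing Implicit Defensive.

Import Order.TTheory GRing.Theory Num.Theory.
Import numFieldNormedType.Exports.

Local Open Scope classical_set_scope.
Local Open Scope ring_scope.

(** * Lipschitz maps and co-mixers *)

Section lipschitz_co_mixer.
Context {R : realType}.
Implicit Types X Y : metricType R.

Lemma metric_lipschitz_continuous X Y (f : X -> Y) :
  metric_lipschitz f -> continuous f.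
Proof.
move=> [L L0 fL] x; apply/metricType_numDomainType.cvgrPdist_lt => e e0.
(* [L] may be [0], hence the [1 + L]. *)
have e'0 : 0 < e / (1 + L) by rewrite divr_gt0// ltr_pwDl.
have xe : \forall y \near x, mdist x y < e / (1 + L).
  exact: metricType_numDomainType.cvgr_dist_lt cvg_id _ e'0.
apply: filterS xe => y /=; rewrite ltr_pdivlMr ?ltr_pwDl// => xy.
apply: le_lt_trans (fL x y) (le_lt_trans _ xy).
by rewrite mulrC ler_wpM2l ?mdist_ge0// lerDr.
Qed.

Lemma lipschitz_co_mixer X (tau : X * X * X -> X) : metric_lipschitz tau ->
    (forall a b, [/\ tau (a, a, b) = b, tau (a, b, a) = b & tau (b, a, a) = b]) ->
  has_lipschitz_co_mixer X.
Proof.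
move=> tauL tauE; exists tau; split => //; split => //.
exact: metric_lipschitz_continuous.
Qed.

Lemma lipschitz_retract_co_mixer X Y (i : X -> Y) (r : Y -> X) :
    isometric i -> metric_lipschitz r -> (forall x, r (i x) = x) ->
  has_lipschitz_co_mixer Y -> has_lipschitz_co_mixer X.
Proof.
move=> iI [K K0 rK] ri [tau [[_ tauE] [L L0 tauL]]].
apply: (@lipschitz_co_mixer _ (fun p => r (tau (i p.1.1, i p.1.2, i p.2)))).
  exists (K * L); first exact: mulr_ge0.
  move=> p q; apply: le_trans (rK _ _) _; rewrite -mulrA ler_wpM2l//.
  by apply: le_trans (tauL _ _) _; rewrite !mdist_prodE/= !iI.
by move=> a b; have [/= -> -> ->] := tauE (i a) (i b); rewrite ri.
Qed.

End lipschitz_co_mixer.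

(** * Normed spaces *)

Section shrink.
Context {R : realType} {V : normedModType R}.
Implicit Types (t : R) (u v : V).

(** At [v = 0] the factor is [0], by the convention [0^-1 = 0]. *)
Definition shrink t v : V := (Num.max 0 (`|v| - t) / `|v|) *: v.

Lemma shrink_norm v : shrink `|v| v = 0.
Proof. by rewrite /shrink subrr maxxx mul0r scale0r. Qed.

Lemma shrink0 v : shrink 0 v = v.
Proof.
rewrite /shrink subr0 max_r//; have [->|v0] := eqVneq v 0.
  by rewrite scaler0.
by rewrite mulfV ?normr_eq0// scale1r.
Qed.

Lemma shrinkr0 t : shrink t 0 = 0.
Proof. by rewrite /shrink scaler0. Qed.

(** With [c] and [c'] the scaling factors of [v] and [v'], the vectors
    [c *: v] and [c *: v'] are close because [c <= 1].  The vectors [c *: v']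
    and [c' *: v'] are parallel, so their distance is the difference of the
    lengths [c * |v'|] and [c' * |v'|]; the first one is close to
    [c * |v| = max 0 (|v| - t)] and the second one is [max 0 (|v'| - t')]. *)
Lemma dist_shrink t t' v v' : 0 <= t -> 0 <= t' ->
  `|shrink t v - shrink t' v'| <= `|t - t'| + 3 * `|v - v'|.
Proof.
move=> t0 t'0; rewrite /shrink.
set c : R := _ / `|v|; set c' : R := _ / `|v'|.
have lenE (s : R) (w : V) : 0 <= s ->
    Num.max 0 (`|w| - s) / `|w| * `|w| = Num.max 0 (`|w| - s).
  move=> s0; have [w0|w0] := eqVneq `|w| 0; last by rewrite divfK.
  by rewrite w0 mulr0 sub0r max_l// oppr_le0.
have cv : c * `|v| = Num.max 0 (`|v| - t) by exact: lenE.
have cv' : c' * `|v'| = Num.max 0 (`|v'| - t') by exact: lenE.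
have c0 : 0 <= c by rewrite divr_ge0// le_max lexx.
have c1 : c <= 1.
  rewrite /c; have [->|v0] := eqVneq `|v| 0; first by rewrite invr0 mulr0.
  by rewrite ler_pdivrMr ?lt0r ?v0//= mul1r ge_max normr_ge0 gerBl.
clearbody c c'.
have -> : c *: v - c' *: v' = c *: (v - v') + (c - c') *: v'.
  by rewrite scalerBr scalerBl addrA subrK.
apply: le_trans (ler_normD _ _) _; rewrite !normrZ (ger0_norm c0).
have dn : `| `|v| - `|v'| | <= `|v - v'| by exact: ler_dist_dist.
have d1 : c * `|v - v'| <= `|v - v'| by rewrite ler_piMl.
have -> : `|c - c'| * `|v'| = `|c * `|v'| - c' * `|v'| |.
  by rewrite -mulrBl normrM normr_id.
have d2 : `|c * `|v'| - c * `|v| | <= `|v - v'|.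
  rewrite -mulrBr normrM (ger0_norm c0) distrC; apply: le_trans dn.
  by rewrite ler_piMl.
have d3 : `|c * `|v| - c' * `|v'| | <= `|v - v'| + `|t - t'|.
  rewrite cv cv'; move: dn (ler_norm (t - t')).
  rewrite !ler_norml => /andP[dn1 dn2] h1.
  have h2 : t' - t <= `|t - t'| by rewrite distrC ler_norm.
  by rewrite /Num.max; do 2 case: ltP => ?; apply/andP; split; lra.
have := ler_distD (c * `|v|) (c * `|v'|) (c' * `|v'|).
lra.
Qed.

Definition norm_co_mixer (p : V * V * V) : V :=
  let: (x, y, z) := p in
  z + (shrink `|y - z| (x - z) + shrink `|x - z| (y - z)).

Lemma norm_co_mixerE (a b : V) :
  [/\ norm_co_mixer (a, a, b) = b, norm_co_mixer (a, b, a) = b &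
      norm_co_mixer (b, a, a) = b].
Proof.
rewrite /norm_co_mixer; split.
- by rewrite !shrink_norm !addr0.
- by rewrite subrr normr0 shrinkr0 shrink0 add0r addrC subrK.
- by rewrite subrr normr0 shrinkr0 shrink0 addr0 addrC subrK.
Qed.

End shrink.

Lemma normed_lipschitz_co_mixer (R : realType) (V : normedModType R) :
  has_lipschitz_co_mixer (normed_metric V).
Proof.
apply: (@lipschitz_co_mixer _ (normed_metric V) (@norm_co_mixer R V));
  last exact: norm_co_mixerE.
(* [17 = 1 + 2 * (2 + 3 * 2)]: changing each point by at most [m] changes [z] by
   [m], and both the shortened vector and the length cut from it by [2 * m]. *)
exists 17 => // -[[x y] z] [[x' y'] z'].
rewrite !mdist_prodE !mdist_normedE/=.
set m := Num.max _ _.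
have xm : `|(x : V) - x'| <= m by rewrite !le_max lexx.
have ym : `|(y : V) - y'| <= m by rewrite !le_max lexx orbT.
have zm : `|(z : V) - z'| <= m by rewrite !le_max lexx orbT.
have bound (a a' : V) : `|a - a'| <= m -> `|(a - z) - (a' - z')| <= 2 * m.
  move=> am; rewrite (_ : _ - _ = (a - a') - (z - z')); last first.
    by rewrite !opprD !opprK addrACA.
  apply: le_trans (ler_normB _ _) _.
  by rewrite mulr_natl mulr2n lerD.
have um := bound _ _ xm; have vm := bound _ _ ym.
have sm := dist_shrink ((x : V) - z) ((x' : V) - z')
  (normr_ge0 ((y : V) - z)) (normr_ge0 ((y' : V) - z')).
have tm := dist_shrink ((y : V) - z) ((y' : V) - z')
  (normr_ge0 ((x : V) - z)) (normr_ge0 ((x' : V) - z')).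
have um' := ler_dist_dist ((x : V) - z) ((x' : V) - z').
have vm' := ler_dist_dist ((y : V) - z) ((y' : V) - z').
have subDD (a b a' b' : V) : (a + b) - (a' + b') = (a - a') + (b - b').
  by rewrite opprD addrACA.
rewrite !subDD.
apply: le_trans (ler_normD _ _) _.
apply: le_trans (lerD zm (ler_normD _ _)) _.
lra.
Qed.

(** * Bounded functions *)

Section bounded_functions.
Context {R : realType} {T : Type}.

Definition bounded_functions : {pred T -> R^o} :=
  [pred f | `[< exists M : R, forall x, `|f x| <= M >]].

Lemma bounded_functions_submod : submod_closed bounded_functions.
Proof.
split; first by apply/asboolP; exists 0 => x; rewrite normr0.
move=> a f g /asboolP[M fM] /asboolP[N gN]; apply/asboolP.
exists (`|a| * M + N) => x; apply: le_trans (ler_normD _ _) _.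
by rewrite lerD// normrZ ler_wpM2l.
Qed.

HB.instance Definition _ := GRing.isSubmodClosed.Build R (T -> R^o)
  bounded_functions bounded_functions_submod.

Record bounded_function :=
  BoundedFunction { bfun :> T -> R^o; _ : bfun \in bounded_functions }.

HB.instance Definition _ := [isSub for bfun].
HB.instance Definition _ := [Choice of bounded_function by <:].
HB.instance Definition _ := [SubChoice_isSubLmodule of bounded_function by <:].

Implicit Types f g : bounded_function.

(** The supremum norm, as the least nonnegative bound rather than as a
    supremum of values: the defining set is nonempty even if [T] is empty. *)
Definition sup_norm f : R :=
  inf [set M | 0 <= M /\ forall x, `|f x| <= M].

Lemma sup_norm_le f M : 0 <= M -> (forall x, `|f x| <= M) -> sup_norm f <= M.
Proof. by move=> M0 fM; apply: ge_inf => //; exists 0 => N []. Qed.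

Lemma le_sup_norm f r : (forall M, 0 <= M -> (forall x, `|f x| <= M) -> r <= M) ->
  r <= sup_norm f.
Proof.
move=> rM; apply: lb_le_inf; last by move=> M [M0 fM]; exact: rM.
case: f {rM} => f /= /asboolP[M fM]; exists `|M|; split => // x.
exact: le_trans (fM x) (ler_norm _).
Qed.

Lemma sup_norm_ge0 f : 0 <= sup_norm f.
Proof. exact: le_sup_norm. Qed.

Lemma normr_le_sup_norm f x : `|f x| <= sup_norm f.
Proof. by apply: le_sup_norm => M _; exact. Qed.

Lemma sup_normD f g : sup_norm (f + g) <= sup_norm f + sup_norm g.
Proof.
apply: sup_norm_le => [|x]; first by rewrite addr_ge0 ?sup_norm_ge0.
by apply: le_trans (ler_normD _ _) _; rewrite lerD ?normr_le_sup_norm.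
Qed.

Lemma sup_normZ (a : R) f : sup_norm (a *: f) = `|a| * sup_norm f.
Proof.
have leZ (b : R) g : sup_norm (b *: g) <= `|b| * sup_norm g.
  apply: sup_norm_le => [|x]; first by rewrite mulr_ge0 ?sup_norm_ge0.
  by rewrite [X in `|X|]/(_ *: _) normrZ ler_wpM2l ?normr_le_sup_norm.
apply/eqP; rewrite eq_le leZ/=.
have [->|a0] := eqVneq a 0; first by rewrite normr0 mul0r sup_norm_ge0.
(* The reverse inequality is [leZ] for the inverse scalar. *)
have := leZ a^-1 (a *: f); rewrite scalerA mulVf// scale1r normfV => fa.
by rewrite -ler_pdivlMl// normr_gt0.
Qed.

Lemma sup_norm0_eq0 f : sup_norm f = 0 -> f = 0.
Proof.
move=> f0; apply/val_inj/funext => x; apply/normr0_eq0/eqP.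
by rewrite eq_le normr_ge0 andbT -f0; exact: normr_le_sup_norm.
Qed.

HB.instance Definition _ := Lmodule_isNormed.Build R bounded_function
  sup_normD sup_normZ sup_norm0_eq0.

End bounded_functions.

Arguments bounded_function : clear implicits.

(** * The Kuratowski embedding *)

Section kuratowski.
Context {R : realType} {X : metricType R}.
Variable x0 : X.

Lemma kuratowski_bounded (x : X) :
  (fun z => mdist x z - mdist x0 z : R^o) \in bounded_functions.
Proof.
apply/asboolP; exists (mdist x x0) => z; rewrite ler_distl.
have := metric_triangle x x0 z; have := metric_triangle x0 x z.
by rewrite (metric_sym x0 x) => *; apply/andP; split; lra.
Qed.

(** Distance functions may be unbounded, but two of them differ by a bounded
    function; hence the base point. *)
Definition kuratowski (x : X) : normed_metric (bounded_function R X) :=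
  BoundedFunction (kuratowski_bounded x).

(** The upper bound is the triangle inequality, and it is attained at [y]. *)
Lemma dist_kuratowski : isometric kuratowski.
Proof.
move=> x y; rewrite mdist_normedE.
have valE z : ((kuratowski x : bounded_function R X) - kuratowski y) z =
    mdist x z - mdist y z by rewrite /= opprB addrA subrK.
apply/eqP; rewrite eq_le; apply/andP; split.
  apply: sup_norm_le => [|z]; first exact: mdist_ge0.
  rewrite valE ler_distl.
  have := metric_triangle x y z; have := metric_triangle y x z.
  by rewrite (metric_sym y x) => *; apply/andP; split; lra.
have := normr_le_sup_norm
  ((kuratowski x : bounded_function R X) - kuratowski y) y.
by rewrite valE mdistxx subr0 ger0_norm ?mdist_ge0.
Qed.

End kuratowski.

Theorem mainTheorem4 (R : realType) :
  (forall V : normedModType R, has_lipschitz_co_mixer (normed_metric V)) /\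
  (forall X : metricType R,
     absolute_lipschitz_retract X -> has_lipschitz_co_mixer X).
Proof.
split=> [V|X [[x0 _] retr]]; first exact: normed_lipschitz_co_mixer.
have [r [rL rK]] := retr _ _ (dist_kuratowski x0).
apply: lipschitz_retract_co_mixer (dist_kuratowski x0) rL rK _.
exact: normed_lipschitz_co_mixer.
Qed.
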